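(* Let $d$ be a positive multiple of $6$, let $n$ be a natural number, and let $\alpha \in (0,1]$. Set $s := \lceil 3\alpha\log_2 n/7\rceil$, $t := \lceil 2\alpha \log_3 n/7\rceil$, $u := \lceil 2\alpha\log_7 n/7\rceil$, and $m := 2^s 3^t 7^u$. Then there is an $\mathsf{AC}^0[42]$ circuit of depth $d+1$ and size $2^{\tilde{O}(n^{6\alpha/(7d)})}$ computing the $\text{MOD}_m$ function on $n$ inputs, where the output gate is an AND gate.
   Context: The $\text{MOD}_m$ function on $n$ inputs outputs $1$ iff the number of ones in the input is divisible by $m$. An $\mathsf{AC}^0[42]$ circuit has unbounded fan-in AND, OR, NOT and $\text{MOD}_{42}$ gates (equivalently, up to wire multiplicities, $\text{MOD}_{m'}$ gates for divisors $m'$ of $42$). Size is the number of gates. $\tilde{O}(\cdot)$ hides polylogarithmic factors in $n$; constants may depend on $d$ and $\alpha$, with $n\to\infty$. *)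

(* Defs.v *)
From mathcomp Require Import all_boot all_order all_algebra.
From mathcomp Require Import all_classical all_reals all_analysis.
Set Implicit Arguments.
Unset Strict Implicit.
Unset Printing Implicit Defensive.
Import Order.TTheory GRing.Theory Num.Theory.
Import numFieldNormedType.Exports.

Definition MOD (m : nat) (bs : seq bool) : bool := m %| count id bs.

(* A circuit is a topologically sorted list of gates; [GateOut j] is the output
   of the [j]-th gate of that list.  Fan-in is unbounded, and a wire may be
   repeated among the arguments of a gate, so that MOD_{m'} for m' | q is a
   single MOD_q gate whose wires all have multiplicity q / m'. *)
Inductive wire (n : nat) : Type :=
| Input of 'I_n
| GateOut of nat.

Inductive gate_op : Type := AND | OR | NOT | MODq.

Record gate (n : nat) : Type := Gate { op : gate_op; args : seq (wire n) }.

Definition wire_ok n (k : nat) (w : wire n) : bool :=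
  if w is GateOut j then j < k else true.

Definition gate_ok n (k : nat) (g : gate n) : bool :=
  all (wire_ok k) (args g) && (if op g is NOT then size (args g) == 1 else true).

Fixpoint gates_ok n (k : nat) (gs : seq (gate n)) : bool :=
  if gs is g :: gs' then gate_ok k g && gates_ok k.+1 gs' else true.

Record circuit (n : nat) : Type := Circuit {
  inner_gates : seq (gate n);
  output_gate : gate n;
  circuit_ok : gates_ok 0 (rcons inner_gates output_gate)
}.

Definition gates n (C : circuit n) : seq (gate n) :=
  rcons (inner_gates C) (output_gate C).

Definition circuit_size n (C : circuit n) : nat := size (gates C).

Definition wire_val n (x : n.-tuple bool) (vals : seq bool) (w : wire n) : bool :=
  match w with
  | Input i => tnth x i
  | GateOut j => nth false vals j
  end.

(* For NOT, [gate_ok] forces [bs] to be a singleton. *)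
Definition op_val (q : nat) (o : gate_op) (bs : seq bool) : bool :=
  match o with
  | AND => all id bs
  | OR => has id bs
  | NOT => ~~ head false bs
  | MODq => MOD q bs
  end.

Definition gate_vals n (q : nat) (x : n.-tuple bool) (gs : seq (gate n)) : seq bool :=
  foldl (fun vals g => rcons vals (op_val q (op g) (map (wire_val x vals) (args g))))
    [::] gs.

Definition circuit_eval n (q : nat) (C : circuit n) (x : n.-tuple bool) : bool :=
  last false (gate_vals q x (gates C)).

Definition computes n (q : nat) (C : circuit n) (F : seq bool -> bool) : Prop :=
  forall x : n.-tuple bool, circuit_eval q C x = F x.

(* Depth is the largest number of gates on a path ending at the output gate;
   every gate counts, including NOT. *)
Definition wire_depth n (ds : seq nat) (w : wire n) : nat :=
  if w is GateOut j then nth 0 ds j else 0.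

Definition gate_depths n (gs : seq (gate n)) : seq nat :=
  foldl (fun ds g => rcons ds (\max_(w <- args g) wire_depth ds w).+1) [::] gs.

Definition circuit_depth n (C : circuit n) : nat := last 0 (gate_depths (gates C)).

Local Open Scope classical_set_scope.
Local Open Scope ring_scope.

Definition logb (R : realType) (b x : R) : R := ln x / ln b.

(* The absolute value only turns an [int] into a [nat]: it is applied to
   nonnegative reals. *)
Definition nceil (R : realType) (x : R) : nat := `|Num.ceil x|%N.

(* f(n) = Õ(g(n)) as n tends to infinity. *)
Definition soft_bigO (R : realType) (f g : nat -> R) : Prop :=
  exists k : nat,
    (f : nat -> R^o) =O_ \oo ((fun n => g n * ln (n%:R) ^+ k) : nat -> R^o).

(* Main.v *)
Require Import Defs.
From mathcomp Require Import all_boot all_order all_algebra.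
From mathcomp Require Import all_classical all_reals all_analysis.
From mathcomp Require Import ring lra.

(* Let c_k be the number of ones among the first k+1 inputs.  The number of
   positions i <= k such that x_i = 1 and p^b | c_i is floor(c_k / p^b), so by
   Lucas' congruence 'C(c, p^l) = floor(c / p^l) mod p, the (b+l)-th base-p digit
   of c_k vanishes iff p divides the number of p^l-element subsets of such
   positions.  Since p^b | c_i means that the b lowest digits of c_i vanish, one
   AND layer followed by one MOD_p layer, with at most about n^(p^J) gates,
   computes J further digits.  Hence r rounds with J about s/r test the s digits
   of the total count that MOD_{p^s} needs, and a final AND gate combines these
   tests for p = 2, 3, 7.  With r = d/2, p^J is O(n^(6 alpha/(7 d))) because
   p^s is O(n^(3 alpha/7)). *)

Set Implicit Arguments.
Unset Strict Implicit.
Unset Printing Implicit Defensive.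
Local Open Scope nat_scope.

(** * Binomial coefficients modulo a prime and base-[p] digits *)

Lemma leq_bin_expn m l : 'C(m, l) <= m ^ l.
Proof.
rewrite (@leq_trans (m ^_ l))//.
  by rewrite -bin_ffact leq_pmulr// fact_gt0.
by elim: l => // l IH; rewrite ffactnSr expnSr leq_mul// leq_subr.
Qed.

(** The identity i C(p^l, i) = p^l C(p^l - 1, i - 1) shows that p^l would divide [i] if [p] did not
    divide the coefficient. *)
Lemma dvdn_bin_primeX p l i :
  prime p -> 0 < i < p ^ l -> p %| 'C(p ^ l, i).
Proof.
move=> p_pr /andP[i_gt0 i_lt]; apply: contraLR i_lt => pndvd.
rewrite -leqNgt dvdn_leq//.
rewrite -(@Gauss_dvdl _ _ 'C(p ^ l, i)); last first.
  by rewrite coprimeXl// prime_coprime.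
by rewrite -(prednK i_gt0) -mul_bin_diag dvdn_mulr.
Qed.

(** Induction on floor(c / p^l): Vandermonde expands C(p^l + e, p^l), and by [dvdn_bin_primeX] only
    the extreme terms C(e, p^l) and 1 survive modulo [p]. *)
Lemma bin_primeX_mod p l c :
  prime p -> 'C(c, p ^ l) = c %/ p ^ l %[mod p].
Proof.
move=> p_pr; have P_gt0 : 0 < p ^ l by rewrite expn_gt0 prime_gt0.
rewrite [in 'C(c, _)](divn_eq c (p ^ l)).
elim: (c %/ p ^ l) => [|b IH].
  by rewrite mul0n add0n bin_small// ltn_mod.
rewrite mulSn -addnA; move: (_ + _) IH => e IH.
rewrite -binomial.Vandermonde big_ord_recr/= subnn bin0 muln1 binn.
rewrite -(prednK P_gt0) big_ord_recl/= prednK// bin0 mul1n subn0.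
have /eqP s0 : p %| \sum_(i < (p ^ l).-1) 'C(p ^ l, bump 0 i) * 'C(e, p ^ l - bump 0 i).
  apply: dvdn_sum => i _; rewrite dvdn_mulr// dvdn_bin_primeX//.
  by rewrite /bump/= add1n -ltn_predRL.
by rewrite addn1 -addSn -modnDmr s0 addn0 -addn1 -modnDml IH modnDml addn1.
Qed.

(** That [p] divides floor(c / p^a) means that the base-[p] digit of index [a] vanishes; digits are
    tested in this form throughout. *)
Lemma dvdn_primeX_digits p b c : 0 < p ->
  (p ^ b %| c) = all (fun a => p %| c %/ p ^ a) (iota 0 b).
Proof.
move=> p_gt0; elim: b => [|b IH]; first by rewrite dvd1n.
rewrite -addn1 iotaD all_cat -IH/= andbT add0n.
have [/dvdnP[e ->]|nd] /= := boolP (p ^ b %| c).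
  by rewrite addn1 expnS mulnK ?expn_gt0 ?p_gt0// dvdn_pmul2r ?expn_gt0 ?p_gt0.
by apply: contraNF nd; apply: dvdn_trans; rewrite addn1 expnS dvdn_mull.
Qed.

(** Repeating every wire q / p times multiplies the count by q / p, so a MOD_q gate acts as a MOD_p
    gate. *)
Lemma MOD_repeat q p bs : 0 < q -> p %| q ->
  MOD q (flatten (nseq (q %/ p) bs)) = MOD p bs.
Proof.
move=> q_gt0 pq; rewrite /MOD count_flatten map_nseq sumn_nseq.
have p_gt0 := dvdn_gt0 q_gt0 pq.
have qp_gt0 : 0 < q %/ p by rewrite divn_gt0// dvdn_leq.
have -> : (q %| count id bs * (q %/ p)) = (q %/ p * p %| q %/ p * count id bs).
  by rewrite divnK// [in RHS]mulnC.
exact: dvdn_pmul2l.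
Qed.

(** * Counting ones in prefixes of the input *)

Definition prefix_count (s : seq bool) (k : nat) : nat :=
  \sum_(j < k.+1) nth false s j.

(** The running count includes position [j] itself, so each positive multiple of [m] up to the total
    is reached at exactly one position carrying a one. *)
Lemma prefix_count_div s m k : 0 < m ->
  \sum_(j < k.+1) (nth false s j && (m %| prefix_count s j) : nat)
    = prefix_count s k %/ m.
Proof.
move=> m_gt0; rewrite /prefix_count; elim: k => [|k IH].
  by rewrite !big_ord1/=; case: (nth _ _ _) => /=; rewrite ?div0n// divnS// div0n addn0.
rewrite big_ord_recr/= IH [in RHS]big_ord_recr/= [in X in _ && X]big_ord_recr/=.
by case: (nth false s k.+1) => /=; rewrite ?addn0// addn1 divnS// addnC.
Qed.

Lemma prefix_count_size s : 0 < size s -> prefix_count s (size s).-1 = count id s.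
Proof.
move=> s_gt0; rewrite /prefix_count prednK// -[in RHS]sumn_count.
rewrite -(big_mkord xpredT (fun j => nth false s j : nat)).
by rewrite -(big_nth false xpredT (fun b : bool => b : nat)) sumnE big_map.
Qed.

Lemma card_prefix n (k : 'I_n) (P : pred nat) :
  #|[set j : 'I_n | (j <= k) && P j]| = \sum_(j < k.+1) P j.
Proof.
rewrite (big_ord_widen n (fun j => P j : nat))// -sum1_card.
rewrite [RHS](eq_bigr (fun j : 'I_n => if P j then 1 else 0)); last by move=> j _; case: P.
by rewrite -big_mkcondr/=; apply: eq_bigl => j; rewrite inE ltnS.
Qed.

(** * Extending gate lists by single gates and by layers *)

Section Circuits.
Variables n q : nat.
Implicit Types (gs hs : seq (gate n)).

Lemma gates_ok_cat k gs hs :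
  gates_ok k (gs ++ hs) = gates_ok k gs && gates_ok (k + size gs) hs.
Proof.
by elim: gs k => [|g gs IH] k /=; rewrite ?addn0// IH -andbA addSnnS.
Qed.

Lemma gate_vals_rcons x gs g : gate_vals q x (rcons gs g) =
  rcons (gate_vals q x gs)
    (op_val q (op g) (map (wire_val x (gate_vals q x gs)) (args g))).
Proof. by rewrite /gate_vals -cats1 foldl_cat. Qed.

Lemma gate_depths_rcons gs g : gate_depths (rcons gs g) =
  rcons (gate_depths gs) (\max_(w <- args g) wire_depth (gate_depths gs) w).+1.
Proof. by rewrite /gate_depths -cats1 foldl_cat. Qed.

Lemma size_gate_vals x gs : size (gate_vals q x gs) = size gs.
Proof.
by elim/last_ind: gs => // gs g IH; rewrite gate_vals_rcons !size_rcons IH.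
Qed.

Lemma size_gate_depths gs : size (gate_depths gs) = size gs.
Proof.
by elim/last_ind: gs => // gs g IH; rewrite gate_depths_rcons !size_rcons IH.
Qed.

Lemma gates_ok_rcons gs g :
  gates_ok 0 (rcons gs g) = gates_ok 0 gs && gate_ok (size gs) g.
Proof. by rewrite -cats1 gates_ok_cat/= andbT. Qed.

(** The depth is only bounded above, so that a wire of an early layer stays available to all later
    ones. *)
Definition realizes gs D (F : n.-tuple bool -> bool) (w : wire n) : Prop :=
  [/\ wire_ok (size gs) w, wire_depth (gate_depths gs) w <= D
    & forall x, wire_val x (gate_vals q x gs) w = F x].

Definition provides gs D F : Prop := exists w, realizes gs D F w.

Lemma eq_provides gs D F F' : F =1 F' -> provides gs D F -> provides gs D F'.
Proof.
by move=> eF [w [wok wd wv]]; exists w; split=> // x; rewrite wv eF.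
Qed.

Lemma wire_depth_rcons gs g (w : wire n) : wire_ok (size gs) w ->
  wire_depth (gate_depths (rcons gs g)) w = wire_depth (gate_depths gs) w.
Proof.
by case: w => //= j jlt; rewrite gate_depths_rcons nth_rcons size_gate_depths jlt.
Qed.

Lemma wire_val_rcons x gs g (w : wire n) : wire_ok (size gs) w ->
  wire_val x (gate_vals q x (rcons gs g)) w = wire_val x (gate_vals q x gs) w.
Proof.
by case: w => //= j jlt; rewrite gate_vals_rcons nth_rcons size_gate_vals jlt.
Qed.

Lemma provides_rcons gs g D F : provides gs D F -> provides (rcons gs g) D F.
Proof.
move=> [w [wok wd wv]]; exists w; split.
- by case: w wok {wd wv} => //= j; rewrite size_rcons => /leqW.
- by rewrite wire_depth_rcons.
- by move=> x; rewrite wire_val_rcons.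
Qed.

Lemma provides_cat gs hs D F : provides gs D F -> provides (gs ++ hs) D F.
Proof.
elim: hs gs => [|h hs IH] gs; first by rewrite cats0.
by move=> gsF; rewrite -cat_rcons; apply: IH; apply: provides_rcons.
Qed.

Lemma leq_provides gs D D' F : D <= D' -> provides gs D F -> provides gs D' F.
Proof.
by move=> DD' [w [wok wd wv]]; exists w; split=> //; apply: leq_trans DD'.
Qed.

Lemma provides_input gs D i : provides gs D (fun x => tnth x i).
Proof. by exists (Input i); split. Qed.

(** The list [ws] follows the order and the repetitions of [us]; the repetitions matter to [MODq]
    gates. *)
Lemma provided_wires (U : eqType) (us : seq U)
    (F : U -> n.-tuple bool -> bool) gs D :
  (forall u, u \in us -> provides gs D (F u)) ->
  exists ws, [/\ all (wire_ok (size gs)) ws,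
    \max_(w <- ws) wire_depth (gate_depths gs) w <= D &
    forall x, map (wire_val x (gate_vals q x gs)) ws = [seq F u x | u <- us]].
Proof.
elim: us => [|u us IH] uF; first by exists [::]; rewrite big_nil.
have [|ws [ok dp vl]] := IH; first by move=> v vus; apply: uF; rewrite inE vus orbT.
have [w [wok wd wv]] := uF u (mem_head _ _).
exists (w :: ws); split=> /= [||x]; first by rewrite wok.
  by rewrite big_cons geq_max wd.
by rewrite wv vl.
Qed.

Lemma append_gate (U : eqType) (us : seq U) (F : U -> n.-tuple bool -> bool)
    o gs D :
  o <> NOT -> gates_ok 0 gs -> (forall u, u \in us -> provides gs D (F u)) ->
  exists g, gates_ok 0 (rcons gs g) /\
    provides (rcons gs g) D.+1 (fun x => op_val q o [seq F u x | u <- us]).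
Proof.
move=> oNOT gs_ok /provided_wires[ws [ws_ok ws_depth ws_val]].
exists (Gate o ws); split.
  by rewrite gates_ok_rcons gs_ok /gate_ok ws_ok/=; case: o oNOT.
exists (GateOut n (size gs)); split=> [||x] /=.
- by rewrite size_rcons.
- by rewrite gate_depths_rcons nth_rcons size_gate_depths ltnn eqxx.
- by rewrite gate_vals_rcons nth_rcons size_gate_vals ltnn eqxx ws_val.
Qed.

(** Every gate of the layer reads wires that were present before it, so the depth grows by one
    however many gates are added. *)
Lemma append_gates (T U : eqType) (ts : seq T) (us : T -> seq U)
    (F : U -> n.-tuple bool -> bool) o gs D :
  o <> NOT -> gates_ok 0 gs ->
  (forall t u, t \in ts -> u \in us t -> provides gs D (F u)) ->
  exists hs, [/\ gates_ok 0 (gs ++ hs), size hs = size ts &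
    forall t, t \in ts -> provides (gs ++ hs) D.+1
      (fun x => op_val q o [seq F u x | u <- us t])].
Proof.
move=> oNOT; elim: ts gs => [|t ts IH] gs gs_ok tF.
  by exists [::]; rewrite cats0.
have [g [g_ok gF]] := append_gate oNOT gs_ok (fun u => tF t u (mem_head _ _)).
have [|hs [hs_ok szhs hsF]] := IH _ g_ok.
  by move=> v u vts uus; apply/provides_rcons/(tF v); rewrite // inE vts orbT.
exists (g :: hs); rewrite -cat_rcons; split=> //=; first by rewrite szhs.
by move=> v; rewrite inE => /predU1P[->|/hsF//]; apply: provides_cat.
Qed.

(** * Computing the digits of all prefix counts *)

(** One round. The AND layer has a gate for each set of p^l positions with l < J, shared by all
    prefixes; the MOD layer has a gate for each pair (l, k). *)
Lemma append_digit_stage p (J b : nat) gs D :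
  prime p -> 0 < q -> p %| q -> gates_ok 0 gs ->
  (forall a (k : 'I_n), a < b ->
     provides gs D (fun x => p %| prefix_count x k %/ p ^ a)) ->
  exists hs, [/\ gates_ok 0 (gs ++ hs), size hs <= J * (n ^ p ^ J + n) &
    forall a (k : 'I_n), a < b + J ->
      provides (gs ++ hs) D.+2 (fun x => p %| prefix_count x k %/ p ^ a)].
Proof.
move=> p_pr q_gt0 pq gs_ok gsF; have p_gt0 := prime_gt0 p_pr.
pose y x (i : 'I_n) := tnth x i && (p ^ b %| prefix_count x i).
(* [None] selects the input bit itself and [Some a] the test of digit [a]; together, for a < b, they
   express [y x i]. *)
pose lit (u : 'I_n * option nat) (x : n.-tuple bool) :=
  if u.2 is Some a then p %| prefix_count x u.1 %/ p ^ a else tnth x u.1.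
pose lits (S : {set 'I_n}) : seq ('I_n * option nat) :=
  [seq (i, o) | i <- enum S, o <- None :: map Some (iota 0 b)].
pose Ss := flatten [seq enum [set S : {set 'I_n} | #|S| == p ^ l] | l <- iota 0 J].
have and_not : AND <> NOT by [].
have mod_not : MODq <> NOT by [].
have [|hs [hs_ok szhs hsF]] :=
    @append_gates _ _ Ss lits lit AND gs D and_not gs_ok.
  move=> S [i [a|]] _ /allpairsP[[i' o] /= [_]]; last first.
    by move=> _ [-> _]; apply: provides_input.
  rewrite inE /= => om [-> oa]; move: om; rewrite -oa /= mem_map; last by move=> ? ? [].
  by rewrite mem_iota => /= ab; apply: gsF.
have {}hsF S : S \in Ss ->
    provides (gs ++ hs) D.+1 (fun x => [forall i in S, y x i]).
  move=> /hsF; apply: eq_provides => x /=.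
  rewrite all_map; apply/idP/idP.
    move=> /allP H; apply/'forall_implyP => i iS; rewrite /y dvdn_primeX_digits//.
    apply/andP; split.
      by apply: (H (i, None)); apply: allpairs_f; rewrite ?mem_enum ?mem_head.
    apply/allP => a ab; apply: (H (i, Some a)); apply: allpairs_f; first by rewrite mem_enum.
    by rewrite inE/= map_f.
  move=> /'forall_implyP H; apply/allP => u /allpairsP[[i o] /= [iS om ->]].
  rewrite mem_enum in iS; have /andP[xi] := H _ iS.
  rewrite dvdn_primeX_digits// => /allP ya.
  by move: om; rewrite inE => /predU1P[->//|/mapP[a aI ->]]; apply: ya.
pose subs (lk : nat * 'I_n) := flatten (nseq (q %/ p)
  (enum [set S : {set 'I_n} | S \subset [set j : 'I_n | j <= lk.2] & #|S| == p ^ lk.1])).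
have [t S|hs' [hs'_ok szhs' hs'F]] := @append_gates _ _
    [seq (l, k) | l <- iota 0 J, k <- enum 'I_n] subs
    (fun S x => [forall i in S, y x i]) MODq (gs ++ hs) D.+1 mod_not hs_ok.
  move=> /allpairsP[[l k] /= [lJ _ ->]] /flattenP[s] /nseqP[-> _].
  rewrite mem_enum inE/= => /andP[_ Sl]; apply: hsF.
  by apply/flattenP; exists (enum [set S : {set 'I_n} | #|S| == p ^ l]);
    [exact: map_f | rewrite mem_enum inE].
exists (hs ++ hs'); rewrite catA; split=> //.
- rewrite size_cat szhs szhs' size_allpairs size_iota -cardE card_ord mulnDr leq_add2r.
  rewrite size_flatten /shape -map_comp sumnE big_map -[X in iota 0 X]subn0.
  rewrite -/(index_iota 0 J).
  rewrite -[X in _ <= X * _](subn0 J) -sum_nat_const_nat !big_nat.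
  apply: leq_sum => l /andP[_ lJ].
  rewrite /= -cardE card_draws card_ord (leq_trans (leq_bin_expn _ _))//.
  (* Powers of [n] increase with the exponent only for positive [n]; for n = 0 both sides vanish,
     the exponents being positive. *)
  have [->|n_gt0] := posnP n; last by rewrite leq_pexp2l// leq_pexp2l// ltnW.
  by rewrite exp0n ?expn_gt0 ?p_gt0.
(* Digits below [b] are already available; digit [a] with a >= b is read from the MOD gate with l =
   a - b. *)
- move=> a k; have [ab _|ba abJ] := ltnP a b.
    apply/provides_cat/provides_cat/(@leq_provides _ D); last exact: gsF.
    by rewrite -addn2 leq_addr.
  have := hs'F (a - b, k).
  move=> /(_ _)/wrap[|].
    by apply: allpairs_f; rewrite ?mem_enum// mem_iota/= add0n ltn_subLR.
  apply: eq_provides => x; rewrite [LHS]/= map_flatten map_nseq MOD_repeat// /MOD count_map.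
  set E := enum _.
  (* The sets counted are the p^(a-b)-element subsets of the positions i <= k satisfying [y x i],
     and [prefix_count_div] gives the number of these positions. *)
  have -> : count (fun S : {set 'I_n} => [forall i in S, y x i]) E =
      'C(prefix_count x k %/ p ^ b, p ^ (a - b)).
    rewrite -prefix_count_div ?expn_gt0 ?p_gt0//.
    rewrite -(card_prefix k (fun j => nth false x j && (p ^ b %| prefix_count x j))).
    rewrite -cards_draws -size_filter cardE; apply/perm_size/uniq_perm.
    - by rewrite filter_uniq// enum_uniq.
    - exact: enum_uniq.
    move=> S; rewrite mem_filter !mem_enum !inE andbA; congr (_ && _).
    apply/idP/idP => [/andP[/'forall_implyP yS kS]|/fintype.subsetP yS].
      apply/fintype.subsetP => i iS; have := fintype.subsetP kS i iS; have := yS i iS.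
      by rewrite !inE /y (tnth_nth false) => -> ->.
    apply/andP; split; [apply/'forall_implyP|apply/fintype.subsetP] => i iS;
      by have := yS i iS; rewrite !inE /y ?(tnth_nth false) => /andP[].
  by rewrite /dvdn bin_primeX_mod// -divnMA -expnD subnKC.
Qed.
(** The first round starts with b = 0, where no digit has to be known; each round adds two
    layers. *)
Lemma append_digits p J r gs :
  prime p -> 0 < q -> p %| q -> gates_ok 0 gs ->
  exists hs, [/\ gates_ok 0 (gs ++ hs), size hs <= r * (J * (n ^ p ^ J + n)) &
    forall a (k : 'I_n), a < r * J ->
      provides (gs ++ hs) r.*2 (fun x => p %| prefix_count x k %/ p ^ a)].
Proof.
move=> p_pr q_gt0 pq gs_ok; elim: r => [|r [hs [hs_ok szhs hsF]]].
  by exists [::]; rewrite cats0.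
have [hs' [hs'_ok szhs' hs'F]] := append_digit_stage J p_pr q_gt0 pq hs_ok hsF.
exists (hs ++ hs'); rewrite catA size_cat !mulSn addnC leq_add//.
by split=> // a k; rewrite addnC; apply: hs'F.
Qed.

(** Sizes add up over the primes but depths do not: the digits for each prime are computed from the
    inputs alone. *)
Lemma append_digits_seq (ps : seq nat) (J : nat -> nat) r gs :
  all prime ps -> 0 < q -> all (dvdn^~ q) ps -> gates_ok 0 gs ->
  exists hs, [/\ gates_ok 0 (gs ++ hs),
    size hs <= \sum_(p <- ps) r * (J p * (n ^ p ^ J p + n)) &
    forall p a (k : 'I_n), p \in ps -> a < r * J p ->
      provides (gs ++ hs) r.*2 (fun x => p %| prefix_count x k %/ p ^ a)].
Proof.
move=> ps_pr q_gt0 psq; elim: ps gs ps_pr psq => [|p ps IH] gs.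
  by exists [::]; rewrite cats0 big_nil.
move=> /= /andP[p_pr ps_pr] /andP[pq psq] gs_ok.
have [hs [hs_ok szhs hsF]] := append_digits (J p) r p_pr q_gt0 pq gs_ok.
have [hs' [hs'_ok szhs' hs'F]] := IH _ ps_pr psq hs_ok.
exists (hs ++ hs'); rewrite catA size_cat big_cons leq_add//.
split=> // p' a k; rewrite inE => /predU1P[->|]; last exact: hs'F.
by move=> ar; apply/provides_cat/hsF.
Qed.

(* Feeding this wire to the output AND gate makes the depth exactly [D.+2]. *)
Lemma append_true_chain D gs : gates_ok 0 gs ->
  exists hs, [/\ gates_ok 0 (gs ++ hs), size hs = D.+1 &
    exists w : wire n, [/\ wire_ok (size (gs ++ hs)) w,
      wire_depth (gate_depths (gs ++ hs)) w = D.+1 &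
      forall x, wire_val x (gate_vals q x (gs ++ hs)) w]].
Proof.
have chain gs0 (ws : seq (wire n)) : gates_ok 0 gs0 -> all (wire_ok (size gs0)) ws ->
    (forall x, all id (map (wire_val x (gate_vals q x gs0)) ws)) ->
  let gs1 := rcons gs0 (Gate AND ws) in
  [/\ gates_ok 0 gs1, wire_ok (size gs1) (GateOut n (size gs0)),
      wire_depth (gate_depths gs1) (GateOut n (size gs0)) =
        (\max_(w <- ws) wire_depth (gate_depths gs0) w).+1 &
      forall x, wire_val x (gate_vals q x gs1) (GateOut n (size gs0))].
  move=> gs0_ok ws_ok ws_val; split=> [||/=|x /=].
  - by rewrite gates_ok_rcons gs0_ok /gate_ok ws_ok.
  - by rewrite /= size_rcons.
  - by rewrite gate_depths_rcons nth_rcons size_gate_depths ltnn eqxx.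
  - by rewrite gate_vals_rcons nth_rcons size_gate_vals ltnn eqxx /= ws_val.
move=> gs_ok; elim: D => [|D [hs [hs_ok szhs [w [w_ok w_depth w_val]]]]].
  have [//|//|gs1_ok ok dp vl] := chain gs [::] gs_ok.
  (* An AND gate without arguments is constantly true and has depth 1. *)
  exists [:: Gate AND [::]]; rewrite cats1; split=> //.
  by exists (GateOut n (size gs)); rewrite dp big_nil.
have [||gs1_ok ok dp vl] := chain (gs ++ hs) [:: w] hs_ok; first by rewrite /= w_ok.
  by move=> x /=; rewrite w_val.
exists (rcons hs (Gate AND [:: w])); rewrite -rcons_cat size_rcons szhs; split=> //.
by exists (GateOut n (size (gs ++ hs))); rewrite dp big_seq1 w_depth.
Qed.

(** The output gate tests, for each [p], the lowest [s p] digits of the count over the longest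
    prefix, which is the whole input. *)
Lemma prime_power_dvd_circuit (ps : seq nat) (s J : nat -> nat) r :
  0 < n -> 0 < r -> all prime ps -> 0 < q -> all (dvdn^~ q) ps ->
  (forall p, p \in ps -> s p <= r * J p) ->
  exists C : circuit n, [/\ circuit_depth C = r.*2.+1,
    circuit_size C <= r.*2.+1 + \sum_(p <- ps) r * (J p * (n ^ p ^ J p + n)),
    op (output_gate C) = AND &
    computes q C (fun bs => all (fun p => p ^ s p %| count id bs) ps)].
Proof.
move=> n_gt0 r_gt0 ps_pr q_gt0 psq sJ.
have [hs [hs_ok szhs hsF]] := @append_digits_seq ps J r [::] ps_pr q_gt0 psq isT.
(* The chain ends at depth exactly [r.*2], the upper bound for the digit wires, so it fixes the
   depth of the output gate. *)
have [hs' [gs_ok szhs' [w [w_ok w_depth w_val]]]] := append_true_chain r.*2.-1 hs_ok.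
rewrite cat0s prednK ?double_gt0// in gs_ok szhs' w_depth w_ok w_val hsF *.
set gs := hs ++ hs' in gs_ok w_ok w_depth w_val.
have k_lt : n.-1 < n by rewrite prednK.
pose us := [seq (p, a) | p <- ps, a <- iota 0 (s p)].
pose F (u : nat * nat) (x : n.-tuple bool) := u.1 %| prefix_count x n.-1 %/ u.1 ^ u.2.
have [|ws [ws_ok ws_depth ws_val]] := @provided_wires _ us F gs r.*2.
  move=> _ /allpairsPdep[p [a [pps + ->]]]; rewrite mem_iota/= => as_.
  by apply: provides_cat; apply: (hsF _ _ (Ordinal k_lt)) => //; apply: leq_trans (sJ _ pps).
have C_ok : gates_ok 0 (rcons gs (Gate AND (w :: ws))).
  by rewrite gates_ok_rcons gs_ok /gate_ok/= w_ok ws_ok.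
exists (Circuit C_ok); split=> //.
- rewrite /circuit_depth /gates/= gate_depths_rcons last_rcons/= big_cons w_depth.
  by rewrite (maxn_idPl ws_depth).
- by rewrite /circuit_size /gates/= size_rcons size_cat szhs' addnC addSn ltnS leq_add2l.
move=> x; rewrite /circuit_eval /gates/= gate_vals_rcons last_rcons/= w_val ws_val/=.
have <- : prefix_count x n.-1 = count id x by rewrite -prefix_count_size ?size_tuple.
rewrite all_map; apply/allP/allP => H.
  move=> p pps; have p_gt0 : 0 < p by apply: prime_gt0; apply: (allP ps_pr).
  rewrite dvdn_primeX_digits//; apply/allP => a aI.
  by apply: (H (p, a)); apply/allpairsPdep; exists p, a.
move=> _ /allpairsPdep[p [a [pps aI ->]]].
have p_gt0 : 0 < p by apply: prime_gt0; apply: (allP ps_pr).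
by move: (H _ pps); rewrite dvdn_primeX_digits// => /allP; apply.
Qed.
End Circuits.

Import Order.TTheory GRing.Theory Num.Theory.
Local Open Scope ring_scope.

(** * Real estimates for the size bound *)

Lemma natr_nceil_le (R : realType) (x : R) : 0 <= x -> (nceil x)%:R <= x + 1.
Proof.
move=> x_ge0; rewrite /nceil natr_absz ger0_norm.
  by have := ceilB1_lt x; rewrite intrB ltrBlDr => /ltW.
by rewrite ceil_ge0 (lt_le_trans _ x_ge0)// ltrN10.
Qed.

(** For x = beta log_p n the exponent is at most (x + 1) / r + 1 <= x / r + 2, and p^(x / r) =
    n^(beta / r); rounding thus costs a factor p^2. *)
Lemma expn_nceil_logb_le (R : realType) (p n r : nat) (beta : R) :
  (1 < p)%N -> (0 < n)%N -> (0 < r)%N -> 0 <= beta ->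
  (p ^ (nceil (beta * logb p%:R n%:R) %/ r).+1)%:R
    <= p%:R ^+ 2 * n%:R `^ (beta / r%:R).
Proof.
move=> p_gt1 n_gt0 r_gt0 beta_ge0.
have p1 : 1 < p%:R :> R by rewrite ltr1n.
have p0 : 0 < p%:R :> R by apply: lt_trans p1.
have lnp : 0 < ln (p%:R : R) by rewrite ln_gt0.
have r1 : 1 <= r%:R :> R by rewrite ler1n.
have r0 : 0 < r%:R :> R by rewrite ltr0n.
have n0 : 0 < n%:R :> R by rewrite ltr0n.
set x := beta * logb _ _.
have x_ge0 : 0 <= x by rewrite mulr_ge0// divr_ge0 ?ln_ge0 ?ler1n// ltnW.
have -> : n%:R `^ (beta / r%:R) = p%:R `^ (x / r%:R).
  rewrite /powR !gt_eqF//; congr expR; rewrite /x /logb; field.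
  by rewrite !gt_eqF.
rewrite -(powR_mulrn _ (ltW p0)) -powRD; last by rewrite (gt_eqF p0) implybT.
rewrite natrX -(powR_mulrn _ (ltW p0)).
apply: ler_powR; first exact: ltW.
suff : (nceil x %/ r)%:R <= x / r%:R + 1 by rewrite -natr1; lra.
have : (nceil x %/ r)%:R * r%:R <= x + 1.
  by rewrite -natrM (le_trans _ (natr_nceil_le x_ge0))// ler_nat leq_divM.
rewrite -ler_pdivlMr// => /le_trans; apply.
by rewrite mulrDl mul1r lerD2l invf_le1.
Qed.

(** Meant for Q = p^J, where the left side bounds the gates of one round: J <= Q <= X and n <= n^Q
    <= n^X. *)
Lemma natr_gate_count_le (R : realType) (n J Q : nat) (X : R) :
  (0 < n)%N -> (J <= Q)%N -> (0 < Q)%N -> Q%:R <= X ->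
  (J * (n ^ Q + n))%:R <= 2 * (X * n%:R `^ X).
Proof.
move=> n_gt0 JQ Q_gt0 QX.
have nX : (n ^ Q)%:R <= n%:R `^ X.
  by rewrite natrX -powR_mulrn// ler_powR// ler1n.
have -> : 2 * (X * n%:R `^ X) = X * (n%:R `^ X + n%:R `^ X) by ring.
rewrite natrM ler_pM// ?(le_trans _ QX) ?ler_nat//.
rewrite natrD lerD// (le_trans _ nX)// ler_nat.
by rewrite -{1}(expn1 n) leq_pexp2l.
Qed.

Lemma soft_bigO_powR_ln (R : realType) (e a b : R) : 0 <= e ->
  soft_bigO (fun n => a + b * n%:R `^ e * (1 + ln n%:R)) (fun n => n%:R `^ e).
Proof.
move=> e_ge0; exists 1%N; apply/eqO_exP.
(* Once n is at least [expR 1], both ln n and n^e are at least 1, so [a] is absorbed and 1 + ln n <=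
   2 ln n; the final 1 makes the constant positive. *)
exists (`|a| + 2 * `|b| + 1); first by rewrite ltr_wpDl// addr_ge0// mulr_ge0.
near=> n.
have n_ge : expR 1 <= n%:R :> R by near: n; exact: nbhs_infty_ger.
have n0 : 0 < n%:R :> R by rewrite (lt_le_trans _ n_ge)// expR_gt0.
have ln1 : 1 <= ln (n%:R : R) by rewrite -[leLHS](expRK 1) ler_ln ?posrE ?expR_gt0.
have n1 : 1 <= n%:R :> R by rewrite (le_trans _ n_ge)// ltW// expR_gt1.
have N1 : 1 <= n%:R `^ e by rewrite -[leLHS](powRr0 n%:R) ler_powR.
rewrite expr1 (ger0_norm (mulr_ge0 _ _)) ?powR_ge0// ?(le_trans _ ln1)//.
apply: (le_trans (ler_normD _ _)).
rewrite !normrM (ger0_norm (powR_ge0 _ _)) [`|1 + _|]ger0_norm; last lra.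
have a0 := normr_ge0 a; have b0 := normr_ge0 b.
move: (ln _) (n%:R `^ e) `|a| `|b| ln1 N1 a0 b0 => l N A B l1 N1 A0 B0.
have Nl : 1 <= N * l by nra.
have h1 : A <= A * (N * l) by rewrite ler_peMr.
have h2 : B * N * (1 + l) <= 2 * B * (N * l).
  have -> : 2 * B * (N * l) = B * N * (l + l) by ring.
  by rewrite ler_wpM2l ?mulr_ge0 ?lerD2r//; lra.
by rewrite !mulrDl; lra.
Unshelve. all: by end_near.
Qed.

Theorem theorem4p4 (R : realType) (d : nat) (alpha : R)
    (d_gt0 : (0 < d)%N) (d_mult6 : (6 %| d)%N)
    (alpha_gt0 : 0 < alpha) (alpha_le1 : alpha <= 1) :
  exists f : nat -> R,
    soft_bigO f (fun n => n%:R `^ (6 * alpha / (7 * d%:R))) /\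
    forall n : nat, (0 < n)%N ->
      let s := nceil (3 * alpha * logb 2 n%:R / 7) in
      let t := nceil (2 * alpha * logb 3 n%:R / 7) in
      let u := nceil (2 * alpha * logb 7 n%:R / 7) in
      let m := (2 ^ s * 3 ^ t * 7 ^ u)%N in
      exists C : circuit n,
        [/\ circuit_depth C = d.+1,
            (circuit_size C)%:R <= 2 `^ f n,
            op (output_gate C) = AND
          & computes 42 C (MOD m)].
Proof.
(* There are r = d / 2 rounds of depth 2, and the output gate brings the depth to d + 1. *)
have [r dE] : exists r, d = r.*2.
  by case/dvdnP: d_mult6 => k ->; exists (k * 3)%N; rewrite -muln2 -mulnA.
have r_gt0 : (0 < r)%N by rewrite -double_gt0 -dE.
have r0 : 0 < r%:R :> R by rewrite ltr0n.
(* The term d + 1 counts the chain and the output gate; 6 r is three primes times [r] rounds times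
   the factor 2 of [natr_gate_count_le]. *)
pose c : R := d.+1%:R + 6 * r%:R.
have c_gt0 : 0 < c by rewrite ltr_pwDl ?ltr0n// mulr_ge0.
have ln2 : 0 < ln (2 : R) by rewrite ln_gt0// ltr1n.
set e := 6 * alpha / (7 * d%:R).
have d0 : 0 < d%:R :> R by rewrite ltr0n.
have e_ge0 : 0 <= e by rewrite divr_ge0// ?mulr_ge0// ltW.
(* This is the base-2 logarithm of c e^X n^X for X = 49 n^e, with the exponent [e] of n set
   above. *)
exists (fun n => ln c / ln 2 + 49 / ln 2 * n%:R `^ e * (1 + ln n%:R)).
split; first exact: soft_bigO_powR_ln.
move=> n n_gt0 s t u m.
have n1 : 1 <= n%:R :> R by rewrite ler1n.
have N1 : 1 <= n%:R `^ e by rewrite -[leLHS](powRr0 n%:R) ler_powR.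
pose J k := (k %/ r).+1.
(* 49 = 7 ^ 2 bounds the factor [p ^ 2] of [expn_nceil_logb_le]. *)
pose X := 49 * n%:R `^ e.
(* The index [i] is 3 for p = 2 and 2 for p = 3, 7. As d = 2 r, the exponent i alpha / (7 r) is at
   most 6 alpha / (7 d). *)
have powJ p (i : nat) : (1 < p <= 7)%N -> (i <= 3)%N ->
    (p ^ J (nceil (i%:R * alpha * logb p%:R n%:R / 7)))%:R <= X.
  move=> /andP[p_gt1 p_le7] i_le3.
  have -> : i%:R * alpha * logb p%:R n%:R / 7 = (i%:R * alpha / 7) * logb p%:R n%:R.
    by rewrite mulrAC.
  apply: (le_trans (expn_nceil_logb_le _ _ _ _)) => //.
    by rewrite divr_ge0// mulr_ge0// ltW.
  rewrite ler_pM ?powR_ge0 ?exprn_ge0//.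
    by rewrite -natrX ler_nat (@leq_exp2r _ 7 2).
  rewrite ler_powR// ler_pdivrMr// /e dE -muln2 natrM.
  have -> : 6 * alpha / (7 * (r%:R * 2)) * r%:R = 3 * alpha / 7.
    by field; rewrite gt_eqF.
  by rewrite ler_pM2r ?invr_gt0// ler_pM2r// ler_nat.
pose S (p : nat) := if p == 2%N then s else if p == 3%N then t else u.
have SJ p : p \in [:: 2; 3; 7]%N -> (S p <= r * J (S p))%N.
  by move=> _; rewrite mulnC ltnW// ltn_ceil.
have [C [C_depth C_size C_op C_val]] :=
  @prime_power_dvd_circuit n 42 [:: 2; 3; 7]%N S (J \o S) r n_gt0 r_gt0 isT isT isT SJ.
exists C; split=> //; first by rewrite C_depth dE.
  pose g p := (J (S p) * (n ^ p ^ J (S p) + n))%N.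
  have gate_le p : p \in [:: 2; 3; 7]%N -> (g p)%:R <= 2 * (X * n%:R `^ X).
    move=> p_in; have p_gt1 : (1 < p)%N by move: p_in; rewrite !inE => /or3P[]/eqP->.
    apply: natr_gate_count_le => //.
    - by rewrite ltnW// ltn_expl.
    - by rewrite expn_gt0 ltnW.
    - move: p_in; rewrite !inE => /or3P[]/eqP->.
      + exact: (powJ 2 3).
      + exact: (powJ 3 2).
      + exact: (powJ 7 2).
  have size_le : (circuit_size C)%:R <= c * (X * n%:R `^ X).
    move: C_size; rewrite -(ler_nat R) -dE => /le_trans; apply.
    rewrite -big_distrr/= natrD natrM /c mulrDl lerD//.
      rewrite ler_peMr// mulr_ege1//.
        by rewrite /X mulr_ege1// ler1n.
      by rewrite -[leLHS](powRr0 n%:R) ler_powR// mulr_ge0// powR_ge0.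
    rewrite [6 * _]mulrC -mulrA ler_wpM2l//.
    rewrite natr_sum !big_cons big_nil.
    move: (gate_le 2 isT) (gate_le 3 isT) (gate_le 7 isT).
    move: (X * _) (g 2)%:R (g 3)%:R (g 7)%:R => Y g2 g3 g7; lra.
  apply: (le_trans size_le).
  (* The factor [X] of the size bound is then absorbed through X <= 1 + X <= e^X. *)
  have -> : 2 `^ (ln c / ln 2 + 49 / ln 2 * n%:R `^ e * (1 + ln n%:R)) =
      c * (expR X * n%:R `^ X) :> R.
    rewrite /powR !gt_eqF ?ltr0n//.
    rewrite -{2}(@lnK _ c) ?posrE// -!expRD; congr expR.
    by rewrite /X /powR gt_eqF ?ltr0n//; field; rewrite gt_eqF.
  rewrite ler_pM2l// ler_wpM2r ?powR_ge0//.
  by apply: le_trans (expR_ge1Dx X); rewrite lerDr.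
(* The three prime powers are pairwise coprime, so divisibility by their product is the conjunction
   of the three tests. *)
move=> x; rewrite C_val /MOD /m /= andbT.
by rewrite !Gauss_dvd ?coprimeMl ?coprimeXl ?coprimeXr// andbA.
Qed.
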